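(* Let $Alg$ be a Strassen-like matrix multiplication algorithm with base case $n_0\times n_0$ using $m$ multiplications, where $\omega_0=\log_{n_0} m$ satisfies $2<\omega_0<3$, and whose base decoding graph $Dec_1C$ is connected. Then there exist constants $c>0$ and $c_0\ge1$, depending only on the base case, with the following property. For every $M\ge1$ and every power $n$ of $n_0$ with $n\ge c_0\sqrt M$, every implementation of $Alg$ on $n\times n$ matrices in the sequential two-level memory model with fast memory of size $M$, without recomputation, moves at least $$c\left(\frac{n}{\sqrt M}\right)^{\omega_0} M$$ words. That is, $IO(n)=\Omega\big((n/\sqrt M)^{\omega_0}M\big)$.
   Context: Strassen-like algorithm: fix a bilinear algorithm multiplying two $n_0\times n_0$ matrices with $m$ multiplications. It forms $m$ linear combinations $L_r(A)$ of entries of $A$ and $m$ linear combinations $L'_r(B)$ of entries of $B$, computes $P_r=L_r(A)L'_r(B)$ for $r=1,\dots,m$, and outputs each $C_{ij}$ as a linear combination of the $P_r$. For $n$ a power of $n_0$, the algorithm on $n\times n$ matrices proceeds as follows: - Split $A,B$ into $n_0^2$ blocks of size $\frac{n}{n_0}\times\frac{n}{n_0}$. - Form the same linear combinations of blocks, computed entrywise by binary scalar additions, subtractions and scalar multiplications. - Multiply the $m$ block pairs by recursive calls; for $n=1$ use a scalar multiplication. - Combine the block products into the blocks of $C$ via the same linear combinations, again entrywise. The base decoding graph $Dec_1C$ is the bipartite graph on the $m$ product vertices $P_1,\dots,P_m$ and the $n_0^2$ output vertices $C_{ij}$. It has an edge $C_{ij}P_r$ iff $P_r$ has a nonzero coefficient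 in the expression of $C_{ij}$. Strassen's algorithm ($n_0=2$, $m=7$) and Winograd's variant satisfy the connectivity hypothesis; the classical algorithm does not. Computation graph (CDAG): a directed acyclic graph with one vertex per input entry and one vertex per scalar arithmetic operation. There is an edge $(u,v)$ whenever the value of $u$ is an operand of the operation $v$. Sequential two-level memory model: - There is a fast memory holding at most $M$ words and an unbounded slow memory. - Inputs start in slow memory, and outputs must end in slow memory. - Arithmetic operations require their operands to be in fast memory and place their results there. - Each word read from slow to fast memory, or written from fast to slow memory, costs one unit. An implementation computes every CDAG vertex exactly once (no recomputation), in an order consistent with the edges. $IO(n)$ is the minimum number of words moved over all implementations. *)

(* Defs.v *)
From Stdlib Require Import Reals.
From HB Require Import structures.
From mathcomp Require Import all_boot all_order all_algebra.

Set Implicit Arguments.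
Unset Strict Implicit.
Unset Printing Implicit Defensive.

Import GRing.Theory.

(* 1. Linear straight-line programs: how the base-case linear combinations   *)
(*    are evaluated by binary additions/subtractions and scalar multiplica-  *)
(*    tions (intermediate results may be shared, as in Winograd's variant). *)
(*    Values are numbered: inputs 0..nin-1, instruction t produces nin+t.    *)

Inductive lin_instr (K : Type) :=
  | LAdd of nat & nat
  | LSub of nat & nat
  | LScale of K & nat.

Record lin_slp (K : Type) := LinSLP {
  slp_code : seq (lin_instr K);
  slp_out  : seq nat }.

Definition instr_args (K : Type) (x : lin_instr K) : seq nat :=
  match x with
  | LAdd i j => [:: i; j]
  | LSub i j => [:: i; j]
  | LScale _ i => [:: i]
  end.

Fixpoint code_wf (K : Type) (cnt : nat) (c : seq (lin_instr K)) : bool :=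
  match c with
  | [::] => true
  | x :: c' => all (fun i => i < cnt) (instr_args x) && code_wf cnt.+1 c'
  end.

Definition slp_wf (K : Type) (nin nout : nat) (p : lin_slp K) : bool :=
  [&& code_wf nin (slp_code p), size (slp_out p) == nout &
      all (fun o => o < nin + size (slp_code p)) (slp_out p)].

Section Forms.
Local Open Scope ring_scope.
Variable K : nzRingType.

(* linear form (coefficient vector over the inputs) computed by each value *)
Definition instr_form (vals : seq (nat -> K)) (x : lin_instr K) : nat -> K :=
  match x with
  | LAdd i j => fun q => nth (fun _ => 0) vals i q + nth (fun _ => 0) vals j q
  | LSub i j => fun q => nth (fun _ => 0) vals i q - nth (fun _ => 0) vals j q
  | LScale a i => fun q => a * nth (fun _ => 0) vals i q
  end.

Fixpoint run_forms (vals : seq (nat -> K)) (c : seq (lin_instr K)) : seq (nat -> K) :=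
  match c with
  | [::] => vals
  | x :: c' => run_forms (rcons vals (instr_form vals x)) c'
  end.

Definition slp_forms (nin : nat) (p : lin_slp K) : seq (nat -> K) :=
  let vals := run_forms [seq (fun q => ((q == i) : nat)%:R) | i <- iota 0 nin]
                        (slp_code p) in
  [seq nth (fun _ => 0) vals o | o <- slp_out p].

Definition bilinear_correct (n0 m : nat)
    (U V : 'I_m -> 'I_n0 -> 'I_n0 -> K) (W : 'I_n0 -> 'I_n0 -> 'I_m -> K) :=
  forall (A B : 'M[K]_n0) (i j : 'I_n0),
    \sum_(r < m) W i j r *
       ((\sum_(I < n0) \sum_(J < n0) U r I J * A I J) *
        (\sum_(I < n0) \sum_(J < n0) V r I J * B I J))
    = (A *m B) i j.

(* A Strassen-like algorithm: a correct bilinear base case with m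
   multiplications, together with straight-line programs evaluating the
   encodings (block (I,J) is input number I*n0+J) and the decoding
   (C_IJ is output number I*n0+J, P_r is input number r). *)
Definition strassen_like (n0 m : nat)
    (U V : 'I_m -> 'I_n0 -> 'I_n0 -> K) (W : 'I_n0 -> 'I_n0 -> 'I_m -> K)
    (encA encB dec : lin_slp K) : Prop :=
  [/\ bilinear_correct U V W,
      [&& slp_wf (n0 * n0) m encA, slp_wf (n0 * n0) m encB & slp_wf m (n0 * n0) dec],
      (forall (r : 'I_m) (I J : 'I_n0),
          nth (fun _ => 0) (slp_forms (n0 * n0) encA) r (I * n0 + J)%N = U r I J),
      (forall (r : 'I_m) (I J : 'I_n0),
          nth (fun _ => 0) (slp_forms (n0 * n0) encB) r (I * n0 + J)%N = V r I J) &
      (forall (I J : 'I_n0) (r : 'I_m),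
          nth (fun _ => 0) (slp_forms m dec) (I * n0 + J)%N r = W I J r)].

(* Base decoding graph Dec_1C: bipartite on products P_r (inl r) and
   outputs C_ij (inr (i,j)), edge iff W i j r <> 0. *)
Definition dec1_rel (n0 m : nat) (W : 'I_n0 -> 'I_n0 -> 'I_m -> K) :
    rel ('I_m + ('I_n0 * 'I_n0))%type :=
  fun x y =>
    match x, y with
    | inl r, inr ij => W ij.1 ij.2 r != 0
    | inr ij, inl r => W ij.1 ij.2 r != 0
    | _, _ => false
    end.

Definition dec1_connected (n0 m : nat) (W : 'I_n0 -> 'I_n0 -> 'I_m -> K) : Prop :=
  forall x y, connect (dec1_rel W) x y.

End Forms.

(* 2. CDAGs: nin input vertices 0..nin-1; operation t is vertex nin+t, with  *)
(*    operand list (its in-neighbours); cd_out lists the output vertices.    *)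

Record cdag := CDAG {
  cd_nin : nat;
  cd_ops : seq (seq nat);
  cd_out : seq nat }.

(* builder state: next fresh vertex id, operations emitted so far (reversed) *)
Definition bstate := (nat * seq (seq nat))%type.

Definition emit (args : seq nat) (st : bstate) : nat * bstate :=
  (st.1, (st.1.+1, args :: st.2)).

Definition emit_block (args_of : nat -> seq nat) (sz : nat) (st : bstate)
    : seq nat * bstate :=
  foldl (fun (acc : seq nat * bstate) p =>
           let r := emit (args_of p) acc.2 in (rcons acc.1 r.1, r.2))
        ([::], st) (iota 0 sz).

Definition blk_args (K : Type) (vals : seq (seq nat)) (x : lin_instr K) (p : nat)
    : seq nat :=
  [seq nth 0 (nth [::] vals i) p | i <- instr_args x].

Fixpoint run_blocks (K : Type) (sz : nat) (vals : seq (seq nat))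
    (c : seq (lin_instr K)) (st : bstate) : seq (seq nat) * bstate :=
  match c with
  | [::] => (vals, st)
  | x :: c' => let r := emit_block (blk_args vals x) sz st in
               run_blocks sz (rcons vals r.1) c' r.2
  end.

Definition apply_slp (K : Type) (sz : nat) (p : lin_slp K) (blocks : seq (seq nat))
    (st : bstate) : seq (seq nat) * bstate :=
  let r := run_blocks sz blocks (slp_code p) st in
  ([seq nth [::] r.1 o | o <- slp_out p], r.2).

(* an (n0*s) x (n0*s) matrix (row-major seq of vertex ids) split into n0^2
   blocks of size s x s; block number I*n0+J is block (I,J) *)
Definition split_blocks (n0 s : nat) (A : seq nat) : seq (seq nat) :=
  [seq [seq nth 0 A (((IJ %/ n0) * s + p %/ s) * (n0 * s) + ((IJ %% n0) * s + p %% s))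
       | p <- iota 0 (s * s)]
  | IJ <- iota 0 (n0 * n0)].

Definition assemble (n0 s : nat) (Cb : seq (seq nat)) : seq nat :=
  [seq let row := q %/ (n0 * s) in let col := q %% (n0 * s) in
       nth 0 (nth [::] Cb ((row %/ s) * n0 + col %/ s)) ((row %% s) * s + col %% s)
  | q <- iota 0 ((n0 * s) * (n0 * s))].

Definition mult_cdag (K : Type) (n0 : nat) (encA encB dec : lin_slp K) :=
  fix go (k : nat) (A B : seq nat) (st : bstate) {struct k} : seq nat * bstate :=
  match k with
  | 0 => let r := emit [:: nth 0 A 0; nth 0 B 0] st in ([:: r.1], r.2)
  | k'.+1 =>
      let s := n0 ^ k' in
      let ra := apply_slp (s * s) encA (split_blocks n0 s A) st in
      let rb := apply_slp (s * s) encB (split_blocks n0 s B) ra.2 in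
      let rp := foldl (fun (acc : seq (seq nat) * bstate) (ab : seq nat * seq nat) =>
                         let r := go k' ab.1 ab.2 acc.2 in (rcons acc.1 r.1, r.2))
                      ([::], rb.2) (zip ra.1 rb.1) in
      let rc := apply_slp (s * s) dec rp.1 rp.2 in
      (assemble n0 s rc.1, rc.2)
  end.

(* CDAG of Alg on n x n matrices, n = n0^k: A_ij is vertex i*n+j,
   B_ij is vertex n^2 + i*n+j. *)
Definition alg_cdag (K : Type) (n0 : nat) (encA encB dec : lin_slp K) (k : nat)
    : cdag :=
  let n := n0 ^ k in
  let r := mult_cdag n0 encA encB dec k (iota 0 (n * n)) (iota (n * n) (n * n))
                     (2 * (n * n), [::]) in
  CDAG (2 * (n * n)) (rev r.2.2) r.1.

Inductive move :=
  | Read of nat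
  | Write of nat
  | Compute of nat
  | Discard of nat.

Record mstate := MState {
  ms_fast : seq nat;
  ms_slow : seq nat;
  ms_done : seq nat }.

Definition add_to (v : nat) (s : seq nat) : seq nat :=
  if v \in s then s else v :: s.

Definition is_op (G : cdag) (v : nat) : bool :=
  (cd_nin G <= v) && (v < cd_nin G + size (cd_ops G)).

Definition op_args (G : cdag) (v : nat) : seq nat :=
  nth [::] (cd_ops G) (v - cd_nin G).

Definition step (M : nat) (G : cdag) (st : mstate) (mv : move) : option mstate :=
  match mv with
  | Read v =>
      let f := add_to v (ms_fast st) in
      if (v \in ms_slow st) && (size f <= M)
      then Some (MState f (ms_slow st) (ms_done st)) else None
  | Write v =>
      if v \in ms_fast st
      then Some (MState (ms_fast st) (add_to v (ms_slow st)) (ms_done st))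
      else None
  | Compute v =>
      let f := add_to v (ms_fast st) in
      if [&& is_op G v, v \notin ms_done st,
             all (fun u => u \in ms_fast st) (op_args G v) & size f <= M]
      then Some (MState f (ms_slow st) (v :: ms_done st)) else None
  | Discard v =>
      Some (MState [seq u <- ms_fast st | u != v] (ms_slow st) (ms_done st))
  end.

Fixpoint run (M : nat) (G : cdag) (st : mstate) (ms : seq move) : option mstate :=
  match ms with
  | [::] => Some st
  | mv :: ms' => match step M G st mv with
                 | Some st' => run M G st' ms'
                 | None => None
                 end
  end.

(* an implementation without recomputation: a legal sequence of moves starting
   with the inputs in slow memory, computing every operation vertex (each at
   most once by legality, hence exactly once), with all outputs in slow memory
   at the end *)
Definition implements (M : nat) (G : cdag) (ms : seq move) : Prop :=
  exists fin, run M G (MState [::] (iota 0 (cd_nin G)) [::]) ms = Some fin /\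
    (forall v, is_op G v -> v \in ms_done fin) /\
    all (fun v => v \in ms_slow fin) (cd_out G).

Definition io_cost (ms : seq move) : nat :=
  count (fun mv => match mv with Read _ | Write _ => true | _ => false end) ms.

Definition omega0 (n0 m : nat) : R := Rdiv (ln (INR m)) (ln (INR n0)).

(* Main.v *)
Require Import Defs.
From Stdlib Require Import Reals.
From HB Require Import structures.
From mathcomp Require Import all_boot all_order all_algebra.
From mathcomp Require Import zify.
From Stdlib Require Import Lra.

(* For a set S of CDAG vertices, call a vertex v a boundary vertex when v is an
   operand of some operation x and exactly one of v, x lies in S.

   Expansion of the decoding graph.  Put N = n0^2.  In a subproblem of size
   n0^t, the decoding consists of copies of the base decoding program, one per
   position p in a block.  Since Dec_1C is connected, a copy whose inputs and
   outputs are not all on the same side of S contains a boundary vertex, and the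
   copies are vertex-disjoint, so at most (#boundary) copies are mixed.  An
   unmixed copy contributes equally to every child's output density and to the
   parent's; hence the density of S among the outputs changes, from a subproblem
   to any of its children, by at most (#boundary)/N^(t-1).  Following this down
   to the single products, where the density is 0 or 1, a subproblem of size n0^j
   at most half of whose m^j products are in S satisfies
     #(products in S) * N^j <= N * m^(j+1) * #boundary,
   and summing over disjoint subproblems gives the same bound for the whole CDAG.

   Input/output.  Cut the run into segments in which exactly m^(j-1) products are
   computed and let S be the set of vertices computed in a segment.  Without
   recomputation, every boundary vertex is in fast memory at the start or at the
   end of the segment, or is read or written in it: #boundary <= 2M + IO.  If j
   is least with N^j >= 3 N m^2 M, each of the m^(k-j+1) segments moves at least
   M words, and n0^j = O(sqrt M). *)

Set Implicit Arguments.
Unset Strict Implicit.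
Unset Printing Implicit Defensive.

Import GRing.Theory.

(** * Colourings constant along operations *)

Section Coloring.

Variable K : nzRingType.
Variable f : nat -> bool.

Fixpoint mono (cnt : nat) (c : seq (lin_instr K)) : bool :=
  match c with
  | [::] => true
  | x :: c' => all (fun a => f a == f cnt) (instr_args x) && mono cnt.+1 c'
  end.

Definition colored (vals : seq (nat -> K)) :=
  forall a r, a < size vals -> nth (fun _ => 0%R) vals a r != 0%R -> f a = f r.

Lemma instr_form_supp (vals : seq (nat -> K)) x r :
  instr_form vals x r != 0%R ->
  exists2 a, a \in instr_args x & nth (fun _ => 0%R) vals a r != 0%R.
Proof.
case: x => [i j|i j|c i] /= H.
- have [Hi|Hi] := eqVneq (nth (fun _ => 0%R) vals i r) 0%R.
    by exists j; rewrite ?inE ?eqxx ?orbT //; move: H; rewrite Hi add0r.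
  by exists i; rewrite ?inE ?eqxx.
- have [Hi|Hi] := eqVneq (nth (fun _ => 0%R) vals i r) 0%R.
    by exists j; rewrite ?inE ?eqxx ?orbT //; move: H; rewrite Hi sub0r oppr_eq0.
  by exists i; rewrite ?inE ?eqxx.
- exists i; rewrite ?inE ?eqxx //.
  by apply: contraNneq H => ->; rewrite mulr0.
Qed.

(** A nonzero coefficient of a combination comes from a nonzero coefficient of one of its operands,
    and that operand has the colour of the result. *)
Lemma colored_run_forms (vals : seq (nat -> K)) c :
  code_wf (size vals) c -> mono (size vals) c -> colored vals ->
  colored (run_forms vals c).
Proof.
elim: c vals => [|x c IH] vals //= /andP[Hx Hc] /andP[Mx Mc] Hv.
apply: IH; rewrite ?size_rcons // => a r.
rewrite size_rcons ltnS nth_rcons leq_eqVlt; case: (ltnP a (size vals)) => [lt _|ge].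
  exact: Hv.
rewrite orbF => /eqP ->; rewrite eqxx => /instr_form_supp [b Hb nz].
by rewrite -(eqP (allP Mx _ Hb)); apply: Hv nz; apply: (allP Hx).
Qed.

Lemma size_run_forms (vals : seq (nat -> K)) c :
  size (run_forms vals c) = size vals + size c.
Proof.
by elim: c vals => [|x c IH] vals /=; rewrite ?addn0 // IH size_rcons addSnnS.
Qed.

Lemma slp_out_color nin nout (p : lin_slp K) q r :
  slp_wf nin nout p -> mono nin (slp_code p) -> q < nout ->
  nth (fun _ => 0%R) (slp_forms nin p) q r != 0%R ->
  f (nth 0 (slp_out p) q) = f r.
Proof.
case/and3P => Hc /eqP Ho Ha Hm Hq.
rewrite /slp_forms (nth_map 0) ?Ho //.
set vals0 := map _ _.
have s0 : size vals0 = nin by rewrite size_map size_iota.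
apply: colored_run_forms; rewrite ?s0 //; last first.
  by rewrite size_run_forms s0; apply: (allP Ha); apply: mem_nth; rewrite Ho.
move=> a r' Hlt; rewrite s0 in Hlt.
rewrite (nth_map 0) ?size_iota // nth_iota // add0n.
by case: (r' =P a) => [->|_] //=; rewrite eqxx.
Qed.

(** Each edge of [Dec_1C] is a nonzero coefficient, so the induced colouring [g] is constant along
    edges, hence constant by connectivity. *)
Lemma dec1_mono n0 m (W : 'I_n0 -> 'I_n0 -> 'I_m -> K) (dec : lin_slp K) :
  slp_wf m (n0 * n0) dec ->
  (forall (I J : 'I_n0) (r : 'I_m),
     nth (fun _ => 0%R) (slp_forms m dec) (I * n0 + J) r = W I J r) ->
  dec1_connected W -> mono m (slp_code dec) ->
  forall r q, r < m -> q < n0 * n0 -> f r = f (nth 0 (slp_out dec) q).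
Proof.
move=> Hwf HW Hconn Hm r q Hr Hq.
pose g (x : 'I_m + ('I_n0 * 'I_n0)) : bool :=
  match x with
  | inl r => f r
  | inr ij => f (nth 0 (slp_out dec) (ij.1 * n0 + ij.2))
  end.
have Hin (I J : 'I_n0) : I * n0 + J < n0 * n0.
  by have := ltn_ord I; have := ltn_ord J; nia.
have edge x y : dec1_rel W x y -> g x = g y.
  case: x y => [r1|[i1 j1]] [r2|[i2 j2]] //= nz.
    by symmetry; apply: (slp_out_color Hwf) => //; rewrite HW.
  by apply: (slp_out_color Hwf) => //; rewrite HW.
have conn x y : connect (dec1_rel W) x y -> g x = g y.
  case/connectP => p; elim: p x => [|z p IH] x /=; first by move=> _ ->.
  by case/andP => /edge -> Hp; apply: IH.
have n0_gt0 : 0 < n0 by case: (n0) Hq; rewrite ?muln0.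
have HI : q %/ n0 < n0 by rewrite ltn_divLR.
have HJ : q %% n0 < n0 by rewrite ltn_mod.
have := conn _ _ (Hconn (inl (Ordinal Hr)) (inr (Ordinal HI, Ordinal HJ))).
by rewrite /= -divn_eq.
Qed.

End Coloring.

(** If two outputs were the same value, their rows of [W] would agree, and so would the
    corresponding entries of every product [A *m B]. A product of two matrix units separates
    them. *)
Lemma slp_out_dec_uniq (K : nzRingType) n0 m
    (U V : 'I_m -> 'I_n0 -> 'I_n0 -> K) (W : 'I_n0 -> 'I_n0 -> 'I_m -> K)
    (dec : lin_slp K) :
  bilinear_correct U V W -> slp_wf m (n0 * n0) dec ->
  (forall (I J : 'I_n0) (r : 'I_m),
     nth (fun _ => 0%R) (slp_forms m dec) (I * n0 + J) r = W I J r) ->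
  uniq (slp_out dec).
Proof.
move=> HUV /and3P[_ /eqP Ho _] HW.
apply/(uniqP 0) => q q'; rewrite !inE Ho => Hq Hq' eqo.
have n0_gt0 : 0 < n0 by case: (n0) Hq; rewrite ?muln0.
have HI : q %/ n0 < n0 by rewrite ltn_divLR.
have HJ : q %% n0 < n0 by rewrite ltn_mod.
have HI' : q' %/ n0 < n0 by rewrite ltn_divLR.
have HJ' : q' %% n0 < n0 by rewrite ltn_mod.
pose I := Ordinal HI; pose J := Ordinal HJ.
pose I' := Ordinal HI'; pose J' := Ordinal HJ'.
have eqW r : W I J r = W I' J' r.
  by rewrite -!HW /= -!divn_eq /slp_forms !(nth_map 0) ?Ho ?eqo.
pose A : 'M[K]_n0 := delta_mx I I; pose B : 'M[K]_n0 := delta_mx I J.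
have := HUV A B I' J'.
under eq_bigr do rewrite -eqW.
rewrite HUV mul_delta_mx !mxE !eqxx /=.
have [eqI|] := eqVneq I' I; last by move=> _ /eqP; rewrite oner_eq0.
have [eqJ _|] := eqVneq J' J; last by move=> _ /eqP; rewrite oner_eq0.
move/(congr1 val): eqI; move/(congr1 val): eqJ => /= e1 e2.
by rewrite (divn_eq q n0) (divn_eq q' n0) e1 e2.
Qed.

(** * Vertices emitted by the builder *)

Definition ext (st st' : bstate) :=
  exists e, st' = (st.1 + size e, e ++ st.2).

Lemma ext_refl st : ext st st.
Proof. by exists [::]; rewrite addn0; case: st. Qed.

Lemma ext_trans st2 st1 st3 : ext st1 st2 -> ext st2 st3 -> ext st1 st3.
Proof.
by case=> [e1 ->] [e2 ->]; exists (e2 ++ e1); rewrite /= size_cat catA -addnA (addnC (size e1)).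
Qed.

Lemma ext_leq st st' : ext st st' -> st.1 <= st'.1.
Proof. by case=> e -> /=; rewrite leq_addr. Qed.

Lemma ext_emit args st : ext st (emit args st).2.
Proof. by exists [:: args]; rewrite addn1. Qed.

(** The operations emitted so far, stored in reverse, are a prefix of those of the finished graph
    [G]. This lets facts about an intermediate builder state speak of [G]. *)
Definition agree (G : cdag) (st : bstate) :=
  st.1 = cd_nin G + size st.2 /\ exists s, cd_ops G = rev st.2 ++ s.

Lemma agree_ext G st st' : ext st st' -> agree G st' -> agree G st.
Proof.
case=> e -> [/= e1 [s e2]]; split.
  by move: e1; rewrite size_cat; lia.
by exists (rev e ++ s); rewrite e2 rev_cat catA.
Qed.

Lemma emit_blockE args_of sz st :
  emit_block args_of sz st =
  (iota st.1 sz, (st.1 + sz, rev [seq args_of p | p <- iota 0 sz] ++ st.2)).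
Proof.
rewrite /emit_block; elim: sz => [|sz IH]; first by rewrite addn0; case: st.
have iotaS x : iota x sz.+1 = rcons (iota x sz) (x + sz).
  by rewrite -addn1 iotaD cats1.
by rewrite !iotaS foldl_rcons IH /= map_rcons rev_rcons add0n addnS.
Qed.

Lemma ext_emit_block args_of sz st : ext st (emit_block args_of sz st).2.
Proof.
rewrite emit_blockE; exists (rev [seq args_of p | p <- iota 0 sz]).
by rewrite size_rev size_map size_iota.
Qed.

Lemma agree_emit_block G args_of sz st p :
  agree G (emit_block args_of sz st).2 -> p < sz ->
  op_args G (st.1 + p) = args_of p /\ is_op G (st.1 + p).
Proof.
rewrite emit_blockE => -[/= e1 [s e2]] Hp.
move: e1; rewrite size_cat size_rev size_map size_iota => e1.
have e3 : st.1 = cd_nin G + size st.2 by lia.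
split.
  rewrite /op_args e2 rev_cat revK -catA e3 -addnA addKn nth_cat size_rev.
  rewrite ltnNge leq_addr /= addKn nth_cat size_map size_iota Hp.
  by rewrite (nth_map 0) ?size_iota // nth_iota.
rewrite /is_op e2 size_cat size_rev size_cat size_rev size_map size_iota; lia.
Qed.

(** * Boundary vertices of a vertex set *)

Definition bnd (G : cdag) (S : pred nat) (v : nat) : bool :=
  has (fun x => (v \in op_args G x) && (S v != S x)) (iota (cd_nin G) (size (cd_ops G))).

(** Counting over intervals of vertex numbers suits the builder: each recursive call owns an
    interval, and the counts of consecutive calls add up. *)
Definition nb (G : cdag) (S : pred nat) (lo hi : nat) : nat :=
  count (bnd G S) (iota lo (hi - lo)).

Lemma bndI G S v x : is_op G x -> v \in op_args G x -> S v != S x -> bnd G S v.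
Proof. by move=> Hx Hv HS; apply/hasP; exists x; rewrite ?mem_iota ?Hv. Qed.

Lemma nbD G S lo mid hi : lo <= mid -> mid <= hi ->
  nb G S lo hi = nb G S lo mid + nb G S mid hi.
Proof.
move=> H1 H2; rewrite /nb -count_cat -[X in iota X (hi - mid)](subnKC H1) -iotaD.
by congr (count _ (iota _ _)); lia.
Qed.

Lemma leq_nb G S lo lo' hi hi' : lo' <= lo -> lo <= hi -> hi <= hi' ->
  nb G S lo hi <= nb G S lo' hi'.
Proof.
move=> H1 H2 H3; have H4 := leq_trans H2 H3.
by rewrite (nbD G S H1 H4) (nbD G S H2 H3) addnCA leq_addr.
Qed.

Section RunBlocks.
Variables (K : nzRingType) (sz : nat).
Implicit Types (vals : seq (seq nat)) (c : seq (lin_instr K)) (st : bstate).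

Lemma ext_run_blocks vals c st : ext st (run_blocks sz vals c st).2.
Proof.
elim: c vals st => [|x c IH] vals st /=; first exact: ext_refl.
exact: ext_trans (ext_emit_block _ _ _) (IH _ _).
Qed.

Lemma run_blocks_vals vals c st :
  exists t, [/\ (run_blocks sz vals c st).1 = vals ++ t, size t = size c,
    all (fun b => size b == sz) t,
    flatten t = iota st.1 (size c * sz) &
    (run_blocks sz vals c st).2.1 = st.1 + size c * sz].
Proof.
elim: c vals st => [|x c IH] vals st /=.
  by exists [::]; rewrite cats0 addn0.
rewrite emit_blockE /=; set st1 := (_, _).
have [t [-> e1 e2 e3 ->]] := IH (rcons vals (iota st.1 sz)) st1.
exists (iota st.1 sz :: t); split; rewrite /= ?e1 ?size_iota ?eqxx //.
- by rewrite cat_rcons.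
- by rewrite e3 mulSn iotaD.
- by rewrite mulSn addnA.
Qed.

(** The entries at position [p] of all blocks form one copy of the program. Either no operation of
    this copy crosses the border of [S], or an operand of a crossing operation is a boundary
    vertex. *)
Lemma run_blocks_bnd G S vals c st p : p < sz ->
  agree G (run_blocks sz vals c st).2 -> code_wf (size vals) c ->
  let vert a := nth 0 (nth [::] (run_blocks sz vals c st).1 a) p in
  mono (fun a => S (vert a)) (size vals) c \/
  exists2 a, a < size vals + size c & bnd G S (vert a).
Proof.
move=> Hp; elim: c vals st => [|x c IH] vals st /=; first by left.
set eb := emit_block _ _ _; set vals' := rcons vals eb.1 => HG /andP[Hx Hc].
set r := run_blocks sz vals' c eb.2 in HG *.
pose vert a := nth 0 (nth [::] r.1 a) p.
have [t [e1 _ _ _ _]] := run_blocks_vals vals' c eb.2.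
have vert_vals a : a < size vals -> vert a = nth 0 (nth [::] vals a) p.
  by move=> Ha; rewrite /vert e1 cat_rcons nth_cat Ha.
have vert_new : vert (size vals) = st.1 + p.
  by rewrite /vert e1 cat_rcons nth_cat ltnn subnn /eb emit_blockE /= nth_iota.
have [] := IH vals' eb.2 HG; first by rewrite size_rcons.
- rewrite size_rcons -/r => Hm.
  have [Hx'|/allPn[a Ha Hne]] :=
      boolP (all (fun a => S (vert a) == S (vert (size vals))) (instr_args x)).
    by left; apply/andP; split.
  right; exists a; first by have /= := allP Hx _ Ha; lia.
  have [Ga Go] := agree_emit_block (agree_ext (ext_run_blocks _ _ _) HG) Hp.
  rewrite -/(vert a); apply: (bndI Go); last by rewrite -vert_new.
  by rewrite Ga; apply/mapP; exists a => //; apply/vert_vals/(allP Hx).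
- by rewrite size_rcons => -[a Ha Hb]; right; exists a => //; rewrite addnS.
Qed.

End RunBlocks.

(** * Disjoint blocks and their assembly into a matrix *)

Lemma flatten_nth_inj (vs : seq (seq nat)) sz a a' p p' :
  uniq (flatten vs) -> all (fun b => size b == sz) vs ->
  a < size vs -> a' < size vs -> p < sz -> p' < sz ->
  nth 0 (nth [::] vs a) p = nth 0 (nth [::] vs a') p' -> a = a' /\ p = p'.
Proof.
elim: vs a a' => [|b vs IH] [|a] [|a'] //=; rewrite cat_uniq => /and3P[Ub Hd Uv] /andP[/eqP sb Hs] Ha Ha' Hp Hp' e.
- by split=> //; apply/eqP; rewrite -(nth_uniq 0 _ _ Ub) ?sb // e.
- case/hasP: Hd; exists (nth 0 b p); last by rewrite mem_nth ?sb.
  rewrite e; apply/flattenP; exists (nth [::] vs a'); rewrite ?mem_nth //.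
  by rewrite (eqP (allP Hs _ _)) ?mem_nth.
- case/hasP: Hd; exists (nth 0 b p'); last by rewrite mem_nth ?sb.
  rewrite -e; apply/flattenP; exists (nth [::] vs a); rewrite ?mem_nth //.
  by rewrite (eqP (allP Hs _ _)) ?mem_nth.
- by have [-> ->] := IH _ _ Uv Hs Ha Ha' Hp Hp' e.
Qed.

(** [phi] sends an entry of the matrix to its block and its position there. It is injective by
    uniqueness of digits, and both index sets have the same size. Counts over outputs thus become
    counts over blocks. *)
Lemma perm_assemble n0 s (Cb : seq (seq nat)) : 0 < n0 -> 0 < s ->
  size Cb = n0 * n0 -> all (fun b => size b == s * s) Cb ->
  perm_eq (assemble n0 s Cb) (flatten Cb).
Proof.
move=> n0_gt0 s_gt0 sC aC.
pose F (x : nat * nat) := nth 0 (nth [::] Cb x.1) x.2.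
pose phi q := let row := q %/ (n0 * s) in let col := q %% (n0 * s) in
  ((row %/ s) * n0 + col %/ s, (row %% s) * s + col %% s).
have -> : assemble n0 s Cb = map F (map phi (iota 0 ((n0 * s) * (n0 * s)))).
  by rewrite -map_comp.
have -> : flatten Cb = map F [seq (i, p) | i <- iota 0 (n0 * n0), p <- iota 0 (s * s)].
  rewrite map_flatten -map_comp; congr flatten.
  apply: (@eq_from_nth _ [::]); first by rewrite size_map size_iota.
  move=> i Hi; rewrite (nth_map 0) ?size_iota ?nth_iota -?sC //= -map_comp.
  have si : size (nth [::] Cb i) = s * s by apply/eqP/(allP aC)/mem_nth.
  apply: (@eq_from_nth _ 0); first by rewrite size_map size_iota.
  by move=> p Hp; rewrite (nth_map 0) ?size_iota ?nth_iota -?si.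
apply: perm_map.
have ns_gt0 : 0 < n0 * s by rewrite muln_gt0 n0_gt0.
have mix a b a' b' d : b < d -> b' < d -> a * d + b = a' * d + b' -> a = a' /\ b = b'.
  move=> Hb Hb' e; have d0 : 0 < d by lia.
  have := congr1 (divn^~ d) e; rewrite !divnMDl // !divn_small // !addn0 => ea.
  by split=> //; move: e; rewrite ea; lia.
have U : uniq (map phi (iota 0 ((n0 * s) * (n0 * s)))).
  rewrite map_inj_in_uniq ?iota_uniq // => q q'.
  rewrite !mem_iota !add0n /= => Hq Hq' [].
  case/mix; rewrite ?ltn_divLR ?ltn_mod // => e1 e2.
  case/mix; rewrite ?ltn_mod // => e3 e4.
  rewrite (divn_eq q (n0 * s)) (divn_eq q' (n0 * s)).
  rewrite (divn_eq (q %/ _) s) (divn_eq (q' %/ _) s) e1 e3.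
  by rewrite (divn_eq (q %% _) s) (divn_eq (q' %% _) s) e2 e4.
apply: uniq_perm => //.
  by apply: allpairs_uniq; rewrite ?iota_uniq // => -[? ?] [? ?].
apply: (uniq_min_size U _ _).2; last first.
  by rewrite size_allpairs size_map !size_iota; lia.
move=> x /mapP[q]; rewrite mem_iota add0n /= => Hq ->.
  apply/allpairsP; exists (phi q); split=> //; rewrite mem_iota /= add0n.
    have h1 : q %/ (n0 * s) %/ s < n0 by rewrite !ltn_divLR // mulnC.
    have h2 : q %% (n0 * s) %/ s < n0 by rewrite ltn_divLR // ltn_mod.
    nia.
  have h1 : q %/ (n0 * s) %% s < s by rewrite ltn_mod.
  have h2 : q %% (n0 * s) %% s < s by rewrite ltn_mod.
  nia.
Qed.

(** * Expansion of the decoding graph *)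

Definition in_range (lo hi v : nat) : bool := (lo <= v) && (v < hi).

Lemma mem_iota_range lo hi v : (v \in iota lo (hi - lo)) = in_range lo hi v.
Proof. by rewrite mem_iota /in_range; apply/idP/idP; lia. Qed.

Lemma all_range_widen lo lo' hi hi' s : lo' <= lo -> hi <= hi' ->
  all (in_range lo hi) s -> all (in_range lo' hi') s.
Proof.
by move=> H1 H2 /allP Hs; apply/allP => v /Hs; rewrite /in_range; lia.
Qed.

(** Here [m >= N + 1] pays for one level of recursion: the children take [N] of the factor [m], the
    mixed copies the remaining 1. *)
Lemma expansion_arith N X m mu nbL nbH : N < m -> nbL <= nbH -> mu <= nbH ->
  N * (N * X * nbL) + N * mu * X <= N * (m * X) * nbH.
Proof.
move=> h1 h2 h3.
have h4 : N * (N * X * nbL) <= N * (N * X * nbH) by rewrite !leq_mul.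
have h5 : N * mu * X <= N * nbH * X by rewrite !leq_mul.
have h6 : N.+1 * (N * X * nbH) <= m * (N * X * nbH) by rewrite leq_mul.
by lia.
Qed.

(** The first two hypotheses give [a <= b], so [b * x] covers the part [a * x] of [a * z]. *)
Lemma half_arith a b x y z n : 2 * a <= n -> a + b = n -> x + y = z ->
  a * z <= a * y + b * x.
Proof.
move=> h1 h2 <-; have h3 : a <= b by lia.
by rewrite mulnDr addnC leq_add2l leq_mul.
Qed.

Lemma uniq_cat_range lo mid hi (s1 s2 : seq nat) :
  uniq s1 -> uniq s2 -> all (in_range lo mid) s1 -> all (in_range mid hi) s2 ->
  lo <= mid -> mid <= hi ->
  uniq (s1 ++ s2) /\ all (in_range lo hi) (s1 ++ s2).
Proof.
move=> U1 U2 A1 A2 H1 H2; split.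
  rewrite cat_uniq U1 U2 andbT /=; apply/hasPn => v /(allP A2) /andP[Hv _].
  by apply/negP => /(allP A1) /andP[_]; lia.
rewrite all_cat; apply/andP; split.
  exact: all_range_widen A1.
exact: all_range_widen A2.
Qed.

Lemma mix_arith N mu X a a' b b' x y x1 y1 nb1 nb2 sz :
  y <= N * y1 + N * mu -> x <= N * x1 + N * mu ->
  a * y1 + b * x1 <= X * nb1 ->
  a' * y + b' * x <= N * (X * nb2) + N * mu * sz ->
  (a + a') * y + (b + b') * x
    <= N * (X * (nb1 + nb2)) + N * mu * (a + b + sz).
Proof.
move=> h3 h4 h1 h2.
have h5 := leq_mul (leqnn a) h3; have h6 := leq_mul (leqnn b) h4.
have h7 := leq_mul (leqnn N) h1.
lia.
Qed.

Lemma sum_nat_const_le (T : eqType) (s : seq T) (F : T -> nat) c :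
  (forall x, x \in s -> F x <= c) -> sumn (map F s) <= size s * c.
Proof.
elim: s => [|x s IH] //= H; rewrite mulSn leq_add ?H ?mem_head // IH // => y Hy.
by rewrite H // inE Hy orbT.
Qed.

Lemma count_pointwise (a b c : pred nat) s :
  (forall x, x \in s -> a x -> b x || c x) -> count a s <= count b s + count c s.
Proof.
elim: s => [|x s IH] //= H.
have := IH (fun y Hy => H y (mem_behead (s := x :: s) Hy)).
have := H x (mem_head _ _).
by case: (a x) (b x) (c x) => [] [] [] //= h; rewrite ?h //; lia.
Qed.

Lemma count_nth (S : pred nat) (s : seq nat) :
  count S s = count (fun p => S (nth 0 s p)) (iota 0 (size s)).
Proof.
rewrite -[s in LHS](mkseq_nth 0) /mkseq count_map; exact: eq_count.
Qed.

Section Expansion.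

Variables (K : nzRingType) (n0 m : nat).
Variables (U V : 'I_m -> 'I_n0 -> 'I_n0 -> K) (W : 'I_n0 -> 'I_n0 -> 'I_m -> K).
Variables (encA encB dec : lin_slp K).
Hypothesis n0_gt0 : 0 < n0.
Hypothesis lt_m : n0 * n0 < m.
Hypothesis Hsl : strassen_like U V W encA encB dec.
Hypothesis Hconn : dec1_connected W.
Variable G : cdag.

Let N := n0 * n0.

Definition sub_expansion t lo hi (L : seq nat) := forall (S : pred nat) j, j <= t ->
  2 * count S L <= m ^ j -> count S L * N ^ j <= N * m ^ j.+1 * nb G S lo hi.

(* A recursive call of size n0^t emits the vertices [lo, hi); C lists its
   outputs and L its scalar products.  The left-hand side of expanding_mix is
   N^t times the sum over L of |density of S among C - indicator of S|. *)
Record expanding t lo hi (C L : seq nat) : Prop := Expanding {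
  expanding_size : size L = m ^ t;
  expanding_uniq : uniq L;
  expanding_range : all (in_range lo hi) L;
  expanding_out_size : size C = N ^ t;
  expanding_out_uniq : uniq C;
  expanding_out_range : all (in_range lo hi) C;
  expanding_mix : forall S : pred nat,
    count S L * count (predC S) C + count (predC S) L * count S C
      <= N * m ^ t.+1 * nb G S lo hi;
  expanding_sub : sub_expansion t lo hi L }.

(* The same for consecutive calls with outputs P and products L altogether; in
   expandings_mix, x and y stand for the numbers of parent outputs inside and
   outside S, and mu for the number of mixed copies of the base decoding. *)
Record expandings t lo hi (P : seq (seq nat)) (L : seq nat) : Prop := Expandings {
  expandings_size : size L = size P * m ^ t;
  expandings_uniq : uniq L;
  expandings_range : all (in_range lo hi) L;
  expandings_out_size : all (fun C => size C == N ^ t) P;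
  expandings_out_uniq : uniq (flatten P);
  expandings_out_range : all (in_range lo hi) (flatten P);
  expandings_mix : forall (S : pred nat) x y mu,
    (forall C, C \in P -> y <= N * count (predC S) C + N * mu /\
                          x <= N * count S C + N * mu) ->
    count S L * y + count (predC S) L * x
      <= N * (N * m ^ t.+1 * nb G S lo hi) + N * mu * size L;
  expandings_sub : sub_expansion t lo hi L }.

Lemma expandings_nil t lo hi : expandings t lo hi [::] [::].
Proof. by split. Qed.

Lemma expandings_cons t lo mid hi C L P Ls :
  lo <= mid -> mid <= hi -> expanding t lo mid C L -> expandings t mid hi P Ls ->
  expandings t lo hi (C :: P) (L ++ Ls).
Proof.
move=> H1 H2 [a1 a2 a3 a4 a5 a6 a7 a8] [b1 b2 b3 b4 b5 b6 b7 b8].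
have [c1 c2] := uniq_cat_range a2 b2 a3 b3 H1 H2.
have [c3 c4] := uniq_cat_range a5 b5 a6 b6 H1 H2.
split=> //=.
- by rewrite size_cat a1 b1 mulSn.
- by rewrite a4 eqxx.
- move=> S x y mu H; rewrite !count_cat (nbD G S H1 H2) size_cat.
  have h1 := a7 S.
  have h2 : count S Ls * y + count (predC S) Ls * x
      <= N * (N * m ^ t.+1 * nb G S mid hi) + N * mu * size Ls.
    by apply: b7 => D HD; apply: H; rewrite inE HD orbT.
  have [h3 h4] := H C (mem_head _ _).
  by rewrite -(count_predC S L); apply: mix_arith h3 h4 (a7 S) h2.
- move=> S j Hj; rewrite count_cat (nbD G S H1 H2) => Hc.
  rewrite mulnDl mulnDr leq_add ?a8 ?b8 //; apply: leq_trans Hc.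
    by rewrite leq_mul2l leq_addr.
  by rewrite leq_mul2l leq_addl.
Qed.

(** The recursive function is abstracted to [go], so that the induction hypothesis for smaller calls
    can be passed in. *)
Lemma expandings_foldl t (go : seq nat -> seq nat -> bstate -> seq nat * bstate) z st P0 :
  (forall A B st, let r := go A B st in
     ext st r.2 /\ (agree G r.2 -> exists L, expanding t st.1 r.2.1 r.1 L)) ->
  let r := foldl (fun (acc : seq (seq nat) * bstate) (ab : seq nat * seq nat) =>
                    let r := go ab.1 ab.2 acc.2 in (rcons acc.1 r.1, r.2))
                 (P0, st) z in
  ext st r.2 /\ exists P, [/\ r.1 = P0 ++ P, size P = size z &
    agree G r.2 -> exists L, expandings t st.1 r.2.1 P L].
Proof.
move=> Hgo; elim: z st P0 => [|[A B] z IH] st P0 /=.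
  split; first exact: ext_refl.
  exists [::]; rewrite cats0; split=> // _; exists [::]; exact: expandings_nil.
have [e1 g1] := Hgo A B st; move: (go A B st) e1 g1 => [C st1] /= e1 g1.
have [e2 [P [-> sP g2]]] := IH st1 (rcons P0 C).
split; first exact: ext_trans e1 e2.
exists (C :: P); split; rewrite ?cat_rcons //= ?sP // => Hag.
have [Ls HLs] := g2 Hag; have [L HL] := g1 (agree_ext e2 Hag).
exists (L ++ Ls); apply: expandings_cons HL HLs; exact: ext_leq.
Qed.

Lemma apply_slp_ext sz (p : lin_slp K) vals st :
  ext st (apply_slp sz p vals st).2 /\
  size (apply_slp sz p vals st).1 = size (slp_out p).
Proof. by split; [exact: ext_run_blocks | rewrite size_map]. Qed.

Let dec_wf : slp_wf m N dec.
Proof. by case: Hsl => _ /and3P[]. Qed.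

Let dec_W (I J : 'I_n0) (r : 'I_m) :
  nth (fun _ => 0%R) (slp_forms m dec) (I * n0 + J) r = W I J r.
Proof. by case: Hsl. Qed.

Let dec_uniq : uniq (slp_out dec).
Proof. by case: Hsl => Hb _ _ _ _; apply: slp_out_dec_uniq Hb _ dec_W. Qed.

Lemma expanding_step t lo st P L s :
  s * s = N ^ t -> 0 < s -> lo <= st.1 -> size P = m ->
  expandings t lo st.1 P L ->
  let r := apply_slp (s * s) dec P st in
  agree G r.2 -> expanding t.+1 lo r.2.1 (assemble n0 s r.1) L.
Proof.
move=> Hs s_gt0 Hlo sP [b1 b2 b3 b4 b5 b6 b7 b8].
set r := run_blocks (s * s) P (slp_code dec) st.
rewrite /apply_slp -/r /= => Hag.
have /and3P[Hcode /eqP So Ho] := dec_wf.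
have [T [e1 e2 e3 e4 e5]] := run_blocks_vals (s * s) P (slp_code dec) st.
rewrite -/r in e1 e5.
have Hhi : st.1 <= r.2.1 by rewrite e5 leq_addr.
have UT : uniq (flatten T) by rewrite e4 iota_uniq.
have AT : all (in_range st.1 r.2.1) (flatten T).
  by apply/allP => v; rewrite e4 mem_iota e5.
(* The children's outputs have numbers below [st.1] and the new blocks start there, so all the
   blocks are pairwise disjoint. *)
have [Uall Aall] := uniq_cat_range b5 UT b6 AT Hlo Hhi.
rewrite -flatten_cat -e1 in Uall Aall.
have szall : all (fun b => size b == s * s) r.1.
  by rewrite e1 all_cat e3 andbT Hs.
have sr : size r.1 = m + size (slp_code dec) by rewrite e1 size_cat sP e2.
pose vert a p := nth 0 (nth [::] r.1 a) p.
have vert_inj a a' p p' : a < size r.1 -> a' < size r.1 -> p < s * s -> p' < s * s ->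
    vert a p = vert a' p' -> a = a' /\ p = p'.
  exact: flatten_nth_inj.
have vsz a : a < size r.1 -> size (nth [::] r.1 a) = s * s.
  by move=> Ha; apply/eqP/(allP szall)/mem_nth.
have vert_in a p : a < size r.1 -> p < s * s -> vert a p \in flatten r.1.
  move=> Ha Hp; apply/flattenP; exists (nth [::] r.1 a); rewrite ?mem_nth ?vsz //.
set Cb := [seq nth [::] r.1 o | o <- slp_out dec].
have sCb : size Cb = N by rewrite size_map So.
have oin o : o \in slp_out dec -> o < size r.1.
  by move/(allP Ho); rewrite sr.
have aCb : all (fun b => size b == s * s) Cb.
  by apply/allP => b /mapP[o /oin Hio ->]; rewrite vsz.
have Hperm : perm_eq (assemble n0 s Cb) (flatten Cb) by exact: perm_assemble.
have sC : size (flatten Cb) = N ^ t.+1.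
  rewrite size_flatten /shape expnS -Hs -sCb.
  by elim: (Cb) aCb => //= b l IH /andP[/eqP-> /IH->]; rewrite mulSn.
have uniqCb : uniq (flatten Cb).
  rewrite /Cb; have Hio := oin; elim: (slp_out dec) dec_uniq Hio => //= o os IH /andP[Hn /IH {}IH] Hin.
  have Ho1 : o < size r.1 by apply: Hin; rewrite mem_head.
  have Hos x : x \in os -> x < size r.1 by move=> Hx; apply: Hin; rewrite inE Hx orbT.
  rewrite cat_uniq IH // andbT; apply/andP; split.
    move: Uall; rewrite -{1}(cat_take_drop o r.1) (drop_nth [::]) // flatten_cat /=.
    by rewrite cat_uniq => /and3P[_ _]; rewrite cat_uniq => /and3P[].
  apply/hasPn => v /flattenP[b /mapP[o' Ho' ->]].
  case/(nthP 0) => p Hp <-; apply/negP; case/(nthP 0) => p' Hp'.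
  rewrite vsz ?Hos // in Hp; rewrite vsz // in Hp'.
  case/vert_inj => //; first exact: Hos.
  by move=> eo _; rewrite eo Ho' in Hn.
have subCb v : v \in flatten Cb -> v \in flatten r.1.
  case/flattenP => b /mapP[o /oin Hio ->] /(nthP 0)[p]; rewrite vsz // => Hp <-.
  exact: vert_in.
have mem_range v : v \in flatten r.1 -> in_range lo r.2.1 v by apply: (allP Aall).
have all_r1_P i : i < m -> nth [::] r.1 i = nth [::] P i.
  by move=> Hi; rewrite e1 nth_cat sP Hi.
(* A copy counts as mixed when it contains a boundary vertex; by [same] below this covers every copy
   whose inputs and outputs meet both sides. *)
pose mx (S : pred nat) p := has (fun a => bnd G S (vert a p)) (iota 0 (size r.1)).
pose mu S := count (mx S) (iota 0 (s * s)).
(* Choosing one boundary vertex in each such copy is injective, as the copies are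
   vertex-disjoint. *)
have mu_nb S : mu S <= nb G S lo r.2.1.
  pose pick p := find (fun a => bnd G S (vert a p)) (iota 0 (size r.1)).
  have pickP p : mx S p -> pick p < size r.1 /\ bnd G S (vert (pick p) p).
    move=> Hmx; have lt_pick : pick p < size r.1.
      by rewrite -[size r.1](size_iota 0) -has_find.
    by split=> //; have := nth_find 0 Hmx; rewrite -/(pick p) nth_iota.
  rewrite /mu /nb -!size_filter -(size_map (fun p => vert (pick p) p)).
  apply: uniq_leq_size.
    rewrite map_inj_in_uniq ?filter_uniq ?iota_uniq // => p p'.
    rewrite !mem_filter !mem_iota !add0n /=.
    case/andP=> /pickP[h1 _] h2 /andP[/pickP[h3 _] h4].
    by case/vert_inj.
  move=> v /mapP[p]; rewrite mem_filter mem_iota add0n /= => /andP[/pickP[h1 h2] h3 ->].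
  by rewrite mem_filter h2 mem_iota_range mem_range ?vert_in.
(* Without a boundary vertex, [S] is constant along the operations of the copy, and connectivity of
   [Dec_1C] puts its inputs and outputs on one side. *)
have same S p i q : p < s * s -> ~~ mx S p -> i < m -> q < N ->
    S (vert i p) = S (vert (nth 0 (slp_out dec) q) p).
  move=> Hp Hmx Hi Hq.
  have Hm : mono (fun a => S (vert a p)) m (slp_code dec).
    rewrite -sP in Hcode *.
    have [//|[a Ha Hb]] := run_blocks_bnd S Hp Hag Hcode.
    case/hasP: Hmx; exists a => //; by rewrite mem_iota sr -sP.
  exact: (dec1_mono dec_wf dec_W Hconn Hm Hi Hq).
(* Position by position, an output block and a child's output agree about [S] outside the mixed
   copies. *)
have block_le S (T' : pred nat) b C : T' = S \/ T' = predC S ->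
    b \in Cb -> C \in P -> count T' b <= count T' C + mu S.
  move=> HT /mapP[o Ho' ->] HC.
  have [q Hq eo] := nthP 0 Ho'; rewrite So in Hq.
  have [i Hi <-] := nthP [::] HC; rewrite sP in Hi.
  rewrite (count_nth T' (nth _ r.1 o)) (count_nth T' (nth _ P i)) vsz ?oin //.
  rewrite -(all_r1_P _ Hi) vsz; last by rewrite sr ltn_addr.
  apply: count_pointwise => p; rewrite mem_iota add0n /= => Hp.
  have [|Hmx] := boolP (mx S p); first by rewrite orbT.
  rewrite orbF; have := same S p i q Hp Hmx Hi Hq; rewrite eo /vert => e.
  by case: HT => -> /=; rewrite e.
have flat_le S (T' : pred nat) C : T' = S \/ T' = predC S -> C \in P ->
    count T' (flatten Cb) <= N * count T' C + N * mu S.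
  move=> HT HC; rewrite count_flatten -mulnDr -[N in leqRHS]sCb.
  by apply: sum_nat_const_le => b Hb; apply: block_le.
have sL : size L = m ^ t.+1 by rewrite b1 sP expnS.
have mix (S : pred nat) : count S L * count (predC S) (flatten Cb)
    + count (predC S) L * count S (flatten Cb) <= N * m ^ t.+2 * nb G S lo r.2.1.
  apply: leq_trans (b7 S _ _ (mu S) _) _.
    by move=> C HC; split; apply: flat_le => //; [right|left].
  rewrite sL (expnS m t.+1).
  by apply: expansion_arith; rewrite ?leq_nb.
have cP (T' : pred nat) : count T' (assemble n0 s Cb) = count T' (flatten Cb).
  exact: (permP Hperm).
split=> //.
- exact: all_range_widen b3.
- by rewrite (perm_size Hperm).
- by rewrite (perm_uniq Hperm).
- by apply/allP => v; rewrite (perm_mem Hperm) => /subCb /mem_range.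
- by move=> S; rewrite !cP; apply: mix.
(* For [j = t + 1] the bound is new and follows from [mix], since [S] has at most half of the
   products. Smaller [j] are inherited from the children. *)
- move=> S j; rewrite leq_eqVlt => /orP[/eqP->|Hj] Hc.
    apply: leq_trans (mix S); rewrite -sC.
    by apply: half_arith Hc _ (count_predC S _); rewrite count_predC.
  apply: leq_trans (b8 S j Hj Hc) _; rewrite leq_mul //.
  exact: leq_nb.
Qed.

Lemma mult_cdag_ext_expanding t A B st :
  let r := mult_cdag n0 encA encB dec t A B st in
  ext st r.2 /\ (agree G r.2 -> exists L, expanding t st.1 r.2.1 r.1 L).
Proof.
elim: t A B st => [|t IH] A B st.
  split; first exact: ext_emit.
  move=> /= Hag; exists [:: st.1]; split=> //=; rewrite ?expn0 /in_range ?leqnn ?ltnSn //.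
  - by move=> S; case: (S st.1).
  (* For [j = 0] the hypothesis [2 * count S L <= 1] leaves no product in [S]. *)
  - by move=> S j; rewrite leqn0 => /eqP->; rewrite /= addn0 !expn0; case: (S st.1); rewrite ?mul0n.
cbn zeta beta iota delta [mult_cdag].
set s := n0 ^ t; set ra := apply_slp _ encA _ _; set rb := apply_slp _ encB _ _.
have [ea sa] := apply_slp_ext (s * s) encA (split_blocks n0 s A) st.
have [eb sb] := apply_slp_ext (s * s) encB (split_blocks n0 s B) ra.2.
rewrite -/ra -/rb in ea sa eb sb.
have [_ /and3P[wa wb _] _ _ _] := Hsl.
have sz : size (zip ra.1 rb.1) = m.
  move: wa wb; rewrite /slp_wf => /and3P[_ /eqP h1 _] /and3P[_ /eqP h2 _].
  by rewrite size_zip sa sb h1 h2 minnn.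
have := expandings_foldl (zip ra.1 rb.1) rb.2 [::] IH.
set rp := foldl _ _ _; cbn zeta => -[ep [P [eP sP HP]]].
have [ed _] := apply_slp_ext (s * s) dec rp.1 rp.2.
have eab := ext_trans ea eb.
split; first exact: ext_trans eab (ext_trans ep ed).
move=> Hag; rewrite cat0s in eP.
have [L HL] := HP (agree_ext ed Hag).
exists L; rewrite eP in Hag *; apply: expanding_step Hag => //.
- by rewrite /s -expnMn.
- by rewrite expn_gt0 n0_gt0.
- exact: leq_trans (ext_leq eab) (ext_leq ep).
- by rewrite sP.
(* The encoding vertices precede those of the children; widening the interval to include them can
   only increase the boundary count. *)
- case: HL => h1 h2 h3 h4 h5 h6 h7 h8.
  have hl := ext_leq eab; have hr := ext_leq ep.
  split=> //.
  + exact: all_range_widen h3.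
  + exact: all_range_widen h6.
  + move=> S x y mu H; apply: leq_trans (h7 S x y mu H) _.
    by rewrite leq_add2r !leq_mul // leq_nb.
  + move=> S j Hj Hc; apply: leq_trans (h8 S j Hj Hc) _.
    by rewrite leq_mul // leq_nb.
Qed.

End Expansion.

(** * Segments of a run *)

Section Pebble.

Variables (M : nat) (G : cdag).

(** The guard [is_op] exempts the inputs, which lie in slow memory from the start and are never
    computed. *)
Record invariant (st : mstate) : Prop := Invariant {
  inv_fast : size (ms_fast st) <= M;
  inv_done : forall v, is_op G v -> (v \in ms_fast st) || (v \in ms_slow st) ->
                v \in ms_done st;
  inv_args : forall x v, x \in ms_done st -> v \in op_args G x -> is_op G v ->
                v \in ms_done st }.

Lemma mem_add_to v u s : (u \in add_to v s) = (u == v) || (u \in s).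
Proof. by rewrite /add_to; case: ifP => // Hv; case: eqP => // ->. Qed.

Lemma step_invariant st mv st' :
  step M G st mv = Some st' -> invariant st -> invariant st'.
Proof.
case: mv => v /=.
- case: ifP => // /andP[Hv Hs] [<-] [h1 h2 h3]; split=> //= u Hu.
  rewrite mem_add_to; case: eqP Hu => [->|_] Hu /=; last exact: h2.
  by move=> _; apply: h2; rewrite ?Hv ?orbT.
- case: ifP => // Hv [<-] [h1 h2 h3]; split=> //= u Hu.
  rewrite mem_add_to; case: eqP Hu => [->|_] Hu /=; last exact: h2.
  by move=> _; apply: h2; rewrite ?Hv.
- case: ifP => // /and4P[Ho Hn Ha Hs] [<-] [h1 h2 h3]; split=> //=.
    move=> u Hu; rewrite mem_add_to inE; case: eqP => //= _; exact: h2.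
  move=> x u; rewrite inE => /orP[/eqP->|Hx] Hu Hou; rewrite inE.
    by rewrite h2 ?orbT // (allP Ha).
  by rewrite (h3 x) ?orbT.
- move=> [<-] [h1 h2 h3]; split=> //=.
    by rewrite size_filter; apply: leq_trans (count_size _ _) h1.
  move=> u Hu; rewrite mem_filter => /orP[/andP[_ H]|H]; apply: h2; rewrite ?H ?orbT //.
Qed.

Lemma run_invariant st ms st' :
  run M G st ms = Some st' -> invariant st -> invariant st'.
Proof.
elim: ms st => [|mv ms IH] st /=; first by case=> ->.
case E: (step _ _ _ _) => [st1|] // Hr Hi.
exact: IH Hr (step_invariant E Hi).
Qed.

Lemma step_done st mv st' v :
  step M G st mv = Some st' -> v \in ms_done st -> v \in ms_done st'.
Proof.
case: mv => u /=; try by [case: ifP => // _ [<-]|move=> [<-]].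
by case: ifP => // _ [<-] /=; rewrite inE => ->; rewrite orbT.
Qed.

Lemma run_done st ms st' v :
  run M G st ms = Some st' -> v \in ms_done st -> v \in ms_done st'.
Proof.
elim: ms st => [|mv ms IH] st /=; first by case=> ->.
case E: (step _ _ _ _) => [st1|] // Hr Hi.
exact: IH Hr (step_done E Hi).
Qed.

Lemma step_fast st mv st' v :
  step M G st mv = Some st' -> v \in ms_fast st' ->
  [\/ v \in ms_fast st, mv = Read v /\ v \in ms_slow st |
      [/\ mv = Compute v, v \notin ms_done st & v \in ms_done st']].
Proof.
case: mv => u /=.
- case: ifP => // /andP[Hu _] [<-] /=; rewrite mem_add_to.
  by case/orP => [/eqP->|]; [constructor 2|constructor 1].
- by case: ifP => // _ [<-] /=; constructor 1.
- case: ifP => // /and4P[_ Hn _ _] [<-] /=; rewrite mem_add_to inE.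
  by case/orP => [/eqP->|]; [constructor 3; rewrite eqxx|constructor 1].
- by move=> [<-] /=; rewrite mem_filter => /andP[_]; constructor 1.
Qed.

Lemma step_slow st mv st' v :
  step M G st mv = Some st' -> v \in ms_slow st' ->
  v \in ms_slow st \/ mv = Write v /\ v \in ms_fast st.
Proof.
case: mv => u /=.
- by case: ifP => // _ [<-]; left.
- case: ifP => // Hu [<-] /=; rewrite mem_add_to.
  by case/orP => [/eqP->|]; [right|left].
- by case: ifP => // _ [<-]; left.
- by move=> [<-]; left.
Qed.

Lemma step_new st mv st' x v :
  step M G st mv = Some st' -> x \in ms_done st' -> x \notin ms_done st ->
  v \in op_args G x -> v \in ms_fast st.
Proof.
case: mv => u /=; try by [case: ifP => // _ [<-] /= ->|move=> [<-] /= ->].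
case: ifP => // /and4P[_ _ Ha _] [<-] /=.
by rewrite inE => /orP[/eqP->|->] // _; apply: (allP Ha).
Qed.

Definition moved (mv : move) : seq nat :=
  match mv with Read v | Write v => [:: v] | _ => [::] end.

Definition io_words (ms : seq move) := flatten (map moved ms).

Lemma size_io_words ms : size (io_words ms) = io_cost ms.
Proof. by elim: ms => [|[v|v|v|v] ms IH] //=; rewrite IH. Qed.

(** When [x] is computed, [v] is in fast memory. Traced back to the start of the segment, [v] was
    already there, was read, or was computed on the way. *)
Lemma run_new_args st ms st' x v :
  run M G st ms = Some st' -> x \in ms_done st' -> x \notin ms_done st ->
  v \in op_args G x ->
  [\/ v \in ms_fast st, v \in io_words ms |
      (v \notin ms_done st) && (v \in ms_done st')].
Proof.
elim: ms st => [|mv ms IH] st /=; first by case=> -> ->.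
case E: (step _ _ _ _) => [st1|] // Hr Hx Hnx Hv.
have [Hx1|Hx1] := boolP (x \in ms_done st1).
  by constructor 1; apply: step_new E Hx1 Hnx Hv.
rewrite /io_words /= mem_cat -/(io_words ms).
case: (IH st1 Hr Hx Hx1 Hv) => [Hf|Hw|/andP[Hd1 Hd2]].
- case: (step_fast E Hf) => [|[-> _]|[_ h1 h2]]; first by constructor 1.
    by constructor 2; rewrite mem_head.
  by constructor 3; rewrite h1 (run_done Hr).
- by constructor 2; rewrite Hw orbT.
- constructor 3; rewrite Hd2 andbT; apply: contraNN Hd1; exact: step_done E.
Qed.

(* A computed value that is in neither memory is lost for good. *)
Lemma run_available st ms st' x v :
  run M G st ms = Some st' -> x \in ms_done st' -> x \notin ms_done st ->
  v \in op_args G x -> v \in ms_done st ->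
  (v \in ms_fast st) || (v \in ms_slow st).
Proof.
elim: ms st => [|mv ms IH] st /=; first by case=> -> ->.
case E: (step _ _ _ _) => [st1|] // Hr Hx Hnx Hv Hd.
have [Hx1|Hx1] := boolP (x \in ms_done st1).
  by rewrite (step_new E Hx1 Hnx Hv).
case/orP: (IH st1 Hr Hx Hx1 Hv (step_done E Hd)) => [Hf|Hs].
  case: (step_fast E Hf) => [->|[_ ->]|[_ h1 _]] //; first by rewrite orbT.
  by rewrite Hd in h1.
by case: (step_slow E Hs) => [->|[_ ->]] //; rewrite orbT.
Qed.

Lemma run_slow st ms st' v :
  run M G st ms = Some st' -> v \in ms_slow st' ->
  v \in ms_slow st \/ v \in io_words ms.
Proof.
elim: ms st => [|mv ms IH] st /=; first by case=> ->; left.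
case E: (step _ _ _ _) => [st1|] // Hr Hv.
rewrite /io_words /= mem_cat -/(io_words ms).
case: (IH st1 Hr Hv) => [/(step_slow E)[|[-> _]]|->]; first by left.
  by right; rewrite mem_head.
by right; rewrite orbT.
Qed.

Lemma segment_bnd st ms1 mid ms2 fin :
  invariant st -> run M G st ms1 = Some mid -> run M G mid ms2 = Some fin ->
  (forall v, is_op G v -> v \in ms_done fin) ->
  nb G (fun v => (v \in ms_done mid) && (v \notin ms_done st)) (cd_nin G) (cd_nin G + size (cd_ops G)) <= 2 * M + io_cost ms1.
Proof.
move=> Hinv H1 H2 Hfin; set S := fun v => _.
have Hinv' := run_invariant H1 Hinv.
have h : size (ms_fast st ++ ms_fast mid ++ io_words ms1) <= 2 * M + io_cost ms1.
  rewrite !size_cat size_io_words; have := inv_fast Hinv; have := inv_fast Hinv'; lia.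
apply: leq_trans h; rewrite /nb -size_filter; apply: uniq_leq_size.
  by rewrite filter_uniq ?iota_uniq.
move=> v; rewrite mem_filter mem_iota_range => /andP[/hasP[x Hx /andP[Hv HS]] Hov].
have ox : is_op G x by move: Hx; rewrite mem_iota.
have ov : is_op G v by [].
rewrite !mem_cat.
(* If [x] is computed in the segment and [v] is not, then [v] was in fast memory at the start or was
   moved. *)
have [Sx|Sx] := boolP (S x).
  case/andP: Sx (Sx) => x1 x2 Sx.
  have Sv : ~~ S v by move: HS; rewrite Sx; case: (S v).
  case: (run_new_args H1 x1 x2 Hv) => [->|->|h] //; rewrite ?orbT //.
  by rewrite /S andbC h in Sv.
(* Now [v] is computed in the segment and [x] only after it, so [v] survives to [mid]: in fast
   memory, or in slow memory, where it was not before and hence was written. *)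
have Sv : S v by move: HS; rewrite (negbTE Sx); case: (S v).
case/andP: Sv => v1 v2.
have x1 : x \notin ms_done st.
  by apply: contraNN v2 => Hd; apply: (inv_args Hinv) Hd Hv ov.
have x2 : x \notin ms_done mid by move: Sx; rewrite /S x1 andbT.
case/orP: (run_available H2 (Hfin _ ox) x2 Hv v1) => [->|/(run_slow H1)[Hs|->]]; rewrite ?orbT //.
by case/negP: v2; apply: (inv_done Hinv) => //; rewrite Hs orbT.
Qed.

(** One move computes at most one vertex, so the number of computed vertices of [L] skips no
    value. *)
Lemma run_split (L : seq nat) Q st ms fin : uniq L ->
  run M G st ms = Some fin ->
  count (mem (ms_done st)) L + Q <= count (mem (ms_done fin)) L ->
  exists ms1 ms2 mid, [/\ ms = ms1 ++ ms2, run M G st ms1 = Some mid,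
    run M G mid ms2 = Some fin &
    count (mem (ms_done mid)) L = count (mem (ms_done st)) L + Q].
Proof.
move=> UL; elim: ms st Q => [|mv ms IH] st Q /=.
  by case=> -> h; exists [::], [::], fin; split=> //=; lia.
case: Q => [|Q]; first by move=> H _; exists [::], (mv :: ms), st; rewrite addn0.
case E: (step _ _ _ _) => [st1|] // Hr Hc.
have Hst : count (mem (ms_done st)) L <= count (mem (ms_done st1)) L
         <= (count (mem (ms_done st)) L).+1.
  rewrite (sub_count (fun v => step_done E)) /=.
  have [u Hu] : exists u, forall v, v \in ms_done st1 -> (v \in ms_done st) || (v == u).
    case: mv E => u /=; try by [case: ifP => // _ [<-]; exists 0 => v ->|move=> [<-]; exists 0 => v ->].
    by case: ifP => // _ [<-]; exists u => v; rewrite inE orbC.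
  apply: leq_trans (count_pointwise (b := mem (ms_done st)) (c := pred1 u) _) _.
    by move=> v _; apply: Hu.
  by rewrite count_uniq_mem // -addn1 leq_add2l leq_b1.
have [Q' HQ'] : exists Q', count (mem (ms_done st1)) L + Q' = count (mem (ms_done st)) L + Q.+1.
  by exists (count (mem (ms_done st)) L + Q.+1 - count (mem (ms_done st1)) L); lia.
rewrite -HQ' in Hc *.
have [ms1 [ms2 [mid [-> h1 h2 h3]]]] := IH st1 Q' Hr Hc.
by exists (mv :: ms1), ms2, mid; split=> //=; rewrite E.
Qed.

(** By [segment_bnd] a segment with [Q] products costs at least [3 * M - 2 * M = M] words; induction
    on the number [g] of segments handles the rest of the run. *)
Lemma run_segments (L : seq nat) Q g st ms fin : uniq L ->
  (forall S : pred nat, count S L = Q ->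
     3 * M <= nb G S (cd_nin G) (cd_nin G + size (cd_ops G))) ->
  invariant st -> run M G st ms = Some fin ->
  (forall v, is_op G v -> v \in ms_done fin) ->
  count (mem (ms_done st)) L + g * Q <= count (mem (ms_done fin)) L ->
  g * M <= io_cost ms.
Proof.
move=> UL HS; elim: g st ms => [|g IH] st ms // Hinv Hr Hfin Hc.
have [|ms1 [ms2 [mid [-> h1 h2 h3]]]] := run_split (Q := Q) UL Hr.
  by apply: leq_trans Hc; rewrite leq_add2l mulSn leq_addr.
have hb := segment_bnd Hinv h1 h2 Hfin.
have hc : count (fun v => (v \in ms_done mid) && (v \notin ms_done st)) L = Q.
  have e1 := count_predC (mem (ms_done st)) (filter (mem (ms_done mid)) L).
  move: e1; rewrite !count_filter size_filter h3.
  rewrite (eq_count (a2 := mem (ms_done st))).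
    move/addnI; move=> <-; by apply: eq_count => v /=; rewrite andbC.
  by move=> v /=; apply: andb_idr; apply: run_done h1.
have h4 := leq_trans (HS _ hc) hb.
have h5 : g * M <= io_cost ms2.
  by apply: IH h2 Hfin _; [exact: run_invariant h1 Hinv | rewrite h3 -addnA -mulSn].
rewrite /io_cost count_cat -/(io_cost ms1) -/(io_cost ms2) mulSn leq_add //.
by rewrite -(leq_add2l (2 * M)) -mulSnr.
Qed.

End Pebble.

(** * The lower bound *)

Lemma segment_arith Q N Y M X b : 0 < Q -> 0 < N -> 0 < Y ->
  3 * N * Y * M <= X -> Q * X <= N * (Q * Y) * b -> 3 * M <= b.
Proof.
move=> Q0 N0 Y0 HX Hb.
have NQY0 : 0 < N * (Q * Y) by rewrite !muln_gt0 N0 Q0.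
rewrite -(leq_pmul2l NQY0); apply: leq_trans Hb.
have := leq_mul (leqnn Q) HX; lia.
Qed.

Lemma io_cost_lower_bound (K : nzRingType) (n0 m : nat)
    (U V : 'I_m -> 'I_n0 -> 'I_n0 -> K) (W : 'I_n0 -> 'I_n0 -> 'I_m -> K)
    (encA encB dec : lin_slp K) M k j impl :
  1 < n0 -> n0 * n0 < m -> strassen_like U V W encA encB dec -> dec1_connected W ->
  0 < j -> j <= k -> 3 * (n0 * n0) * m ^ 2 * M <= (n0 * n0) ^ j ->
  implements M (alg_cdag n0 encA encB dec k) impl ->
  m ^ (k - j).+1 * M <= io_cost impl.
Proof.
move=> n0_gt1 lt_m Hsl Hconn j_gt0 le_jk HM [fin [Hrun [Hfin _]]].
have n0_gt0 : 0 < n0 by apply: ltnW.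
have m_gt0 : 0 < m by apply: leq_ltn_trans lt_m.
move: Hrun Hfin; set G := alg_cdag _ _ _ _ _ => Hrun Hfin.
have := @mult_cdag_ext_expanding _ _ _ _ _ _ encA encB dec n0_gt0 lt_m Hsl Hconn
  G k (iota 0 (n0 ^ k * n0 ^ k)) (iota (n0 ^ k * n0 ^ k) (n0 ^ k * n0 ^ k))
  (2 * (n0 ^ k * n0 ^ k), [::]).
cbn zeta; set r := mult_cdag _ _ _ _ _ _ _ _ => -[[e re] HL].
have opsE : cd_ops G = rev r.2.2 by [].
have ninE : cd_nin G = 2 * (n0 ^ k * n0 ^ k) by [].
have hiE : r.2.1 = cd_nin G + size (cd_ops G).
  by rewrite opsE ninE re /= cats0 size_rev.
have [|L HLx] := HL.
  split; first by rewrite hiE opsE size_rev.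
  by exists [::]; rewrite cats0.
case: HLx => sL UL AL _ _ _ _ subL.
rewrite /= -ninE hiE in AL subL.
(* With [Q = m^(j-1)], [m >= 2] gives [2 * Q <= m^j], and the [m^k] products fill exactly
   [m^(k-j+1)] segments. *)
apply: (run_segments (L := L) (Q := m ^ j.-1) UL _ _ Hrun Hfin) => //=.
- move=> S cS; have := subL S j le_jk; rewrite cS.
  have m_gt1 : 1 < m by apply: leq_trans lt_m; rewrite ltnS muln_gt0 n0_gt0.
  have -> : m ^ j = m * m ^ j.-1 by rewrite -expnS prednK.
  rewrite leq_mul // => /(_ isT).
  have -> : m ^ j.+1 = m ^ j.-1 * m ^ 2 by rewrite -expnD addn2 prednK.
  by apply: segment_arith HM; rewrite ?expn_gt0 ?muln_gt0 ?m_gt0 ?n0_gt0.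
- split=> // v /andP[Hv _] /=.
  by rewrite mem_iota add0n leq0n ltnNge Hv.
- rewrite (eq_count (a2 := pred0)) // count_pred0 add0n -expnD.
  have -> : (k - j).+1 + j.-1 = k by rewrite addSnnS prednK // subnK.
  rewrite -sL; apply/eq_leq/esym/eqP; rewrite -all_count.
  by apply/allP => v /(allP AL) Hv; apply: Hfin.
Qed.

(** * The exponent and the constants over the reals *)

Local Open Scope R_scope.

(** This is [n0^omega_0 = m] raised to the power [i]; it turns powers of [m] into powers with
    exponent [omega_0]. *)
Lemma Rpower_omega0 n0 m i : (1 < n0)%N -> (0 < m)%N ->
  Rpower (INR (n0 ^ i)) (omega0 n0 m) = INR (m ^ i).
Proof.
move=> n0_gt1 m_gt0.
have INR_expn a b : INR (a ^ b)%N = pow (INR a) b.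
  elim: b => [|b IH]; first by rewrite expn0.
  by rewrite expnS mult_INR IH.
have h0 : 1 < INR n0 by apply: (lt_INR 1); apply/ltP.
have hm : 0 < INR m by apply: (lt_INR 0); apply/ltP.
have hl : 0 < ln (INR n0) by rewrite -ln_1; apply: ln_increasing; lra.
rewrite /Rpower /omega0 !INR_expn ln_pow; last lra.
replace (ln (INR m) / ln (INR n0) * (INR i * ln (INR n0))) with (INR i * ln (INR m)).
  by rewrite -ln_pow // exp_ln //; apply: pow_lt.
field; lra.
Qed.

Lemma lt_sqr_of_omega0 n0 m : (1 < n0)%N -> 2 < omega0 n0 m -> (n0 * n0 < m)%N.
Proof.
move=> n0_gt1 Hw.
have h0 : 1 < INR n0 by apply: (lt_INR 1); apply/ltP.
have hl : 0 < ln (INR n0) by rewrite -ln_1; apply: ln_increasing; lra.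
have hm : 0 < ln (INR m).
  have : 2 * ln (INR n0) < ln (INR m).
    apply: (Rmult_lt_reg_r (/ ln (INR n0))); first exact: Rinv_0_lt_compat.
    rewrite Rmult_assoc Rinv_r; [move: Hw; rewrite /omega0 /Rdiv; lra|lra].
  lra.
have m_gt0 : (0 < m)%N.
  (* For [m = 0] the logarithm takes its default value 0, which contradicts [hm]. *)
  case: m hm {Hw} => // h; exfalso; move: h; rewrite /= /ln.
  by case: Rlt_dec => [?|_] h; lra.
have hm' : 0 < INR m by apply: (lt_INR 0); apply/ltP.
rewrite ltnNge; apply/negP => /leP/le_INR; rewrite mult_INR => hle.
have : ln (INR m) <= 2 * ln (INR n0).
  replace (2 * ln (INR n0)) with (ln (INR n0 * INR n0)); last first.
    rewrite ln_mult; lra.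
  case: (Rle_lt_or_eq_dec _ _ hle) => [hlt|->]; last lra.
  by apply: Rlt_le; apply: ln_increasing.
move=> h.
have : omega0 n0 m <= 2.
  apply: (Rmult_le_reg_r (ln (INR n0))) => //.
  rewrite /omega0 /Rdiv Rmult_assoc Rinv_l; lra.
lra.
Qed.

Theorem theorem2 (K : nzRingType) (n0 m : nat)
    (U V : 'I_m -> 'I_n0 -> 'I_n0 -> K) (W : 'I_n0 -> 'I_n0 -> 'I_m -> K)
    (encA encB dec : lin_slp K) :
  (1 < n0)%N ->
  strassen_like U V W encA encB dec ->
  Rlt (INR 2) (omega0 n0 m) -> Rlt (omega0 n0 m) (INR 3) ->
  dec1_connected W ->
  exists c c0 : R, Rlt R0 c /\ Rle R1 c0 /\
    forall (M k : nat), (1 <= M)%N ->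
      Rle (Rmult c0 (sqrt (INR M))) (INR (n0 ^ k)) ->
      forall impl : seq move, implements M (alg_cdag n0 encA encB dec k) impl ->
      Rle (Rmult c (Rmult (Rpower (Rdiv (INR (n0 ^ k)) (sqrt (INR M))) (omega0 n0 m))
                          (INR M)))
          (INR (io_cost impl)).
Proof.
move=> n0_gt1 Hsl Hw _ Hconn.
have lt_m : (n0 * n0 < m)%N by apply: lt_sqr_of_omega0 => //; move: Hw => /=; lra.
have m_gt0 : (0 < m)%N by apply: leq_ltn_trans lt_m.
have h0 : 1 < INR n0 by apply: (lt_INR 1); apply/ltP.
have hm : 1 <= INR m by apply: (le_INR 1); apply/leP.
have h0m : 1 <= INR m * INR n0 by nra.
(* With [N = n0^2], the square [9 * N * m^2] of [c0] exceeds the factor [3 * N * m^2] in the choice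
   of [j], so [n >= c0 * sqrt M] forces [j <= k]. *)
pose c0 := 3 * INR m * INR n0.
(* The base of [c] matches the bound [n0^j <= c0 * n0 * sqrt M], which gives
   [n / (c0 * n0 * sqrt M) <= n0^(k-j)]. *)
exists (Rpower (/ (c0 * INR n0)) (omega0 n0 m)), c0; split; first exact: exp_pos.
split; first by rewrite /c0; nra.
move=> M k M_gt0 Hn impl Himpl.
have hM : 0 < INR M by apply: (lt_INR 0); apply/ltP.
have hs : 0 < sqrt (INR M) by apply: sqrt_lt_R0.
have hss : sqrt (INR M) * sqrt (INR M) = INR M by apply: sqrt_sqrt; lra.
have n0N : (1 < n0 * n0)%N by rewrite -[1%N]/(1 * 1)%N ltn_mul.
have exj : exists j, (3 * (n0 * n0) * m ^ 2 * M <= (n0 * n0) ^ j)%N.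
  by exists (3 * (n0 * n0) * m ^ 2 * M)%N; apply/ltnW/ltn_expl.
case: (ex_minnP exj) => j Hj minj.
have pos_lhs : (1 < 3 * (n0 * n0) * m ^ 2 * M)%N.
  have : (0 < m ^ 2)%N by rewrite expn_gt0 m_gt0.
  by nia.
have j_gt0 : (0 < j)%N by case: j Hj {minj} => //; rewrite expn0; lia.
have Hj1 : ((n0 * n0) ^ j.-1 < 3 * (n0 * n0) * m ^ 2 * M)%N.
  by rewrite ltnNge; apply/negP => /minj; lia.
have expn_sqr i : ((n0 * n0) ^ i = n0 ^ i * n0 ^ i)%N by rewrite expnMn.
have le_jk : (j <= k)%N.
  apply: minj; rewrite expn_sqr; apply/leP/INR_le; rewrite !mult_INR.
  have hc : 3 * (INR n0 * INR n0) * (INR m * INR m) * INR M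
      <= (c0 * sqrt (INR M)) * (c0 * sqrt (INR M)).
    replace ((c0 * sqrt (INR M)) * (c0 * sqrt (INR M))) with
      (9 * (INR n0 * INR n0) * (INR m * INR m) * (sqrt (INR M) * sqrt (INR M)));
      last by rewrite /c0; ring.
    rewrite hss; have : 0 <= INR n0 * INR n0 * (INR m * INR m) * INR M
      by repeat apply: Rmult_le_pos; lra.
    lra.
  have -> : INR 3 = 3 by rewrite /=; lra.
  apply: Rle_trans hc _.
  have hc0 : 0 <= c0 * sqrt (INR M) by rewrite /c0; repeat apply: Rmult_le_pos; lra.
  exact: Rmult_le_compat.
have Hio := io_cost_lower_bound n0_gt1 lt_m Hsl Hconn j_gt0 le_jk Hj Himpl.
(* One factor [m] is given up, so that the power of [m] matches [n0^(k-j)]. *)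
have {}Hio : (m ^ (k - j) * M <= io_cost impl)%N.
  apply: leq_trans Hio; rewrite leq_mul // leq_exp2l //.
  exact: ltn_trans n0N lt_m.
have hnj : INR (n0 ^ j)%N <= c0 * INR n0 * sqrt (INR M).
  have hle : (n0 ^ j * n0 ^ j <= 3 * (n0 * n0) * (n0 * n0) * m ^ 2 * M)%N.
    rewrite -expn_sqr -(prednK j_gt0) expnS.
    by have := leq_mul (leqnn (n0 * n0)%N) (ltnW Hj1); lia.
  move/leP/le_INR: hle; rewrite !mult_INR.
  have -> : INR 3 = 3 by rewrite /=; lra.
  set x := INR (n0 ^ j)%N => hx.
  have hy : 0 <= c0 * INR n0 * sqrt (INR M).
    by rewrite /c0; repeat apply: Rmult_le_pos; lra.
  apply: Rsqr_incr_0_var hy; rewrite /Rsqr; apply: Rle_trans hx _.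
  replace (c0 * INR n0 * sqrt (INR M) * (c0 * INR n0 * sqrt (INR M))) with
    (9 * (INR n0 * INR n0 * (INR n0 * INR n0) * (INR m * INR m))
       * (sqrt (INR M) * sqrt (INR M))); last by rewrite /c0; ring.
  rewrite hss; set Z := INR n0 * INR n0 * (INR n0 * INR n0) * (INR m * INR m).
  have hZ : 0 <= Z * INR M by rewrite /Z; repeat apply: Rmult_le_pos; lra.
  replace (3 * (INR n0 * INR n0) * (INR n0 * INR n0) * (INR m * INR m) * INR M)
    with (3 * (Z * INR M)); last by rewrite /Z; ring.
  lra.
apply: Rle_trans (le_INR _ _ (leP Hio)); rewrite mult_INR -Rmult_assoc.
apply: Rmult_le_compat_r; first lra.
have hk : INR (n0 ^ k)%N = INR (n0 ^ (k - j))%N * INR (n0 ^ j)%N.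
  by rewrite -[in LHS](subnK le_jk) expnD mult_INR.
have hden : 0 < c0 * INR n0 * sqrt (INR M).
  by rewrite /c0; repeat apply: Rmult_lt_0_compat; lra.
have hinv : 0 < / (c0 * INR n0).
  by apply: Rinv_0_lt_compat; rewrite /c0; repeat apply: Rmult_lt_0_compat; lra.
have hn : 0 < INR (n0 ^ k)%N.
  by apply: (lt_INR 0); apply/ltP; rewrite expn_gt0 ltnW.
have hq : 0 < INR (n0 ^ (k - j))%N.
  by apply: (lt_INR 0); apply/ltP; rewrite expn_gt0 ltnW.
(* After this rewriting both sides are powers with exponent [omega_0 > 0], and it suffices to
   compare their bases. *)
rewrite -(Rpower_omega0 (k - j) n0_gt1 m_gt0) Rpower_mult_distr //; last first.
  exact: Rdiv_lt_0_compat.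
apply: Rle_Rpower_l; first by move: Hw => /=; lra.
split; first by apply: Rmult_lt_0_compat => //; exact: Rdiv_lt_0_compat.
apply: (Rmult_le_reg_r (c0 * INR n0 * sqrt (INR M))) => //.
replace (/ (c0 * INR n0) * (INR (n0 ^ k)%N / sqrt (INR M))
           * (c0 * INR n0 * sqrt (INR M))) with (INR (n0 ^ k)%N).
  by rewrite hk; apply: Rmult_le_compat_l => //; lra.
by rewrite /c0; field; repeat split; lra.
Qed.
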